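(* Let $R$ be a commutative Noetherian ring of prime characteristic $p$ that is $F$-finite, let $I$ be an injective $R$-module, and fix an $(R,R)$-bimodule isomorphism $\Psi : {}_fI \to \operatorname{Hom}_{rR}(R_f, I)$. Let $\mathcal{L}_I$ be the category of all left $R[x,f]$-modules that are $I$-reflexive as $R$-modules (and all left $R[x,f]$-homomorphisms between them), and let $\mathcal{R}_I$ be the category of all right $R[x,f]$-modules that are $I$-reflexive as $R$-modules (and all right $R[x,f]$-homomorphisms between them). Then the functors $\mathbf{D} : \mathcal{L}_I \to (\mathcal{R}_I)^{\mathrm{op}}$ and $\mathbf{D}' : \mathcal{R}_I \to (\mathcal{L}_I)^{\mathrm{op}}$ (described in the context) are inverse equivalences of categories.
   Context: $f : R \to R$, $f(r)=r^p$, is the Frobenius homomorphism; $R$ is $F$-finite if $f$ is a finite ring homomorphism. The Frobenius skew polynomial ring $R[x,f]$ is freely generated as a left $R$-module by $(x^i)_{i\ge 0}$, with multiplication subject to $xr = r^p x$ for $r\in R$. Left and right $R[x,f]$-modules are regarded as $R$-modules by restriction of scalars; since $R$ is commutative, $R$-modules are regarded as both left and right $R$-modules. Bimodules: $R_f$ is $R$ as an Abelian group with $r\cdot m\cdot s = r s^p m$; ${}_fI$ is $I$ as an Abelian group with $r\cdot z\cdot s = r^p s z$. $\operatorname{Hom}_{rR}(R_f,I)$ is the group of right $R$-homomorphisms $R_f\to I$ (additive $\psi$ with $\psi(rs^p)=\psi(r)s$), an $(R,R)$-bimodule via $(s\psi s')(r) = s\,\psi(s'r)$. An isomorphism $\Psi$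 as in the claim exists when $R$ is $F$-finite and $I$ is injective. It makes $I$ a right $R[x,f]$-module via $zx = (\Psi(z))(1)$ for $z\in I$. Write $G^\vee = \operatorname{Hom}_R(G,I)$ for an $R$-module $G$. An $R$-module $G$ is $I$-reflexive if the evaluation map $\omega_G : G \to (G^\vee)^\vee$, $\omega_G(g)(h)=h(g)$, is an isomorphism; if $G$ is $I$-reflexive then so is $G^\vee$. The contravariant functor $\mathbf{D}$ from left $R[x,f]$-modules to right $R[x,f]$-modules sends a left $R[x,f]$-module $H$ to $H^\vee$ with its usual $R$-module structure and right action of $x$ given by $(mx)(h) = (\Psi(m(xh)))(1)$ for $m\in H^\vee$, $h \in H$. The contravariant functor $\mathbf{D}'$ from right $R[x,f]$-modules to left $R[x,f]$-modules sends a right $R[x,f]$-module $M$ to $M^\vee$ with its usual $R$-module structure and left action of $x$ given by $(xh)(m) = \Psi^{-1}\big(r' \mapsto h((mr')x)\big)$ for $h\in M^\vee$, $m\in M$. On morphisms, $\mathbf{D}(\varphi)=\varphi^\vee$ and $\mathbf{D}'(\psi)=\psi^\vee$. These restrict to functors between $\mathcal{L}_I$ and $\mathcal{R}_I$. *)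

(* Defs.v *)
From HB Require Import structures.
From mathcomp Require Import all_boot all_algebra.
From mathcomp Require Import boolp classical_sets.

Set Implicit Arguments.
Unset Strict Implicit.
Unset Printing Implicit Defensive.

Import GRing.Theory.
Local Open Scope ring_scope.

Definition noetherian (R : comNzRingType) : Prop :=
  forall J : set R,
    J 0 -> (forall a b, J a -> J b -> J (a + b)) ->
    (forall r a, J a -> J (r * a)) ->
  exists s : seq R,
    J = [set a | exists c : nat -> R, a = \sum_(i < size s) c i * s`_i]%classic.

Definition finite_rmorphism (A B : comNzRingType) (f : A -> B) : Prop :=
  exists s : seq B, forall b : B,
    exists c : nat -> A, b = \sum_(i < size s) f (c i) * s`_i.

Definition F_finite (R : comNzRingType) (p : nat) (charRp : p \in [pchar R]) :
  Prop := finite_rmorphism (pFrobenius_aut charRp).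

Definition injective_module (R : pzRingType) (I : lmodType R) : Prop :=
  forall (A B : lmodType R) (i : {linear A -> B}) (g : {linear A -> I}),
    injective i -> exists h : {linear B -> I}, forall a, h (i a) = g a.

Lemma linear_ext (R : pzRingType) (U V : lmodType R) (f g : {linear U -> V}) :
  f =1 g -> f = g.
Proof.
case: f => f [[fD] [fZ]]; case: g => g [[gD] [gZ]] /= /funext e.
case: _ / e in gD gZ *.
by rewrite (Prop_irrelevance fD gD) (Prop_irrelevance fZ gZ).
Qed.

Section LinearFunctions.
Variables (R : comNzRingType) (G I : lmodType R).
Implicit Types f g h : {linear G -> I}.

HB.instance Definition _ := gen_eqMixin {linear G -> I}.
HB.instance Definition _ := gen_choiceMixin {linear G -> I}.

Fact lin_addA : associative (fun f g => f \+ g : {linear G -> I}).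
Proof. by move=> f g h; apply: linear_ext => v /=; rewrite addrA. Qed.
Fact lin_addC : commutative (fun f g => f \+ g : {linear G -> I}).
Proof. by move=> f g; apply: linear_ext => v /=; rewrite addrC. Qed.
Fact lin_add0 :
  left_id (\0 : {linear G -> I}) (fun f g => f \+ g : {linear G -> I}).
Proof. by move=> f; apply: linear_ext => v /=; rewrite add0r. Qed.
Fact lin_addN : left_inverse (\0 : {linear G -> I})
  (fun f => \- f : {linear G -> I}) (fun f g => f \+ g : {linear G -> I}).
Proof. by move=> f; apply: linear_ext => v /=; rewrite addNr. Qed.

HB.instance Definition _ := GRing.isZmodule.Build {linear G -> I}
  lin_addA lin_addC lin_add0 lin_addN.

Fact lin_scaleA a b f :
  a \*: (b \*: f : {linear G -> I}) = (a * b) \*: f :> {linear G -> I}.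
Proof. by apply: linear_ext => v /=; rewrite scalerA. Qed.
Fact lin_scale1 : left_id 1 (fun a f => a \*: f : {linear G -> I}).
Proof. by move=> f; apply: linear_ext => v /=; rewrite scale1r. Qed.
Fact lin_scaleDr :
  right_distributive (fun a f => a \*: f : {linear G -> I}) +%R.
Proof. by move=> a f g; apply: linear_ext => v /=; rewrite scalerDr. Qed.
Fact lin_scaleDl f :
  {morph (fun a => a \*: f : {linear G -> I}) : a b / a + b}.
Proof. by move=> a b; apply: linear_ext => v /=; rewrite scalerDl. Qed.

HB.instance Definition _ := GRing.Zmodule_isLmodule.Build R {linear G -> I}
  lin_scaleA lin_scale1 lin_scaleDr lin_scaleDl.

Lemma lin_addE f g v : (f + g) v = f v + g v. Proof. by []. Qed.
Lemma lin_scaleE a f v : (a *: f) v = a *: f v. Proof. by []. Qed.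

End LinearFunctions.

Section Reflexive.
Variables (R : comNzRingType) (I : lmodType R).

Definition dual (G : lmodType R) : lmodType R := {linear G -> I}.

Section DualMap.
Variables (G H : lmodType R) (phi : {linear G -> H}).
Definition dual_map (m : dual H) : dual G := m \o phi : {linear G -> I}.
Fact dual_map_is_linear : linear dual_map.
Proof. by move=> a m n; apply: linear_ext. Qed.
HB.instance Definition _ := GRing.isLinear.Build R (dual H) (dual G) *:%R
  dual_map dual_map_is_linear.
End DualMap.

Section Evaluation.
Variables (G : lmodType R).

Section EvalAt.
Variable g : G.
Definition eval_at (h : dual G) : I := h g.
Fact eval_at_is_linear : linear eval_at.
Proof. by []. Qed.
HB.instance Definition _ := GRing.isLinear.Build R (dual G) I *:%R
  eval_at eval_at_is_linear.
End EvalAt.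

Definition omega (g : G) : dual (dual G) := eval_at g : {linear dual G -> I}.
Fact omega_is_linear : linear omega.
Proof. by move=> a g h; apply: linear_ext => m /=; rewrite /eval_at linearP. Qed.
HB.instance Definition _ := GRing.isLinear.Build R G (dual (dual G)) *:%R
  omega omega_is_linear.
End Evaluation.

Definition reflexive_module (G : lmodType R) : Prop := bijective (@omega G).

Lemma reflexive_iso (G H : lmodType R) (phi : {linear G -> H}) :
  bijective phi -> reflexive_module G -> reflexive_module H.
Proof.
case=> psi phiK psiK [w wK Kw].
have psi_lin : linear psi.
  by move=> a x y; rewrite -[RHS]phiK linearP !psiK.
pose psiM := GRing.isLinear.Build R H G *:%R psi psi_lin.
pose psiL : {linear H -> G} := HB.pack psi psiM.
pose w' (z : dual (dual H)) : H := phi (w (dual_map (dual_map psiL) z)).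
exists w' => [h | z]; rewrite /w'.
  rewrite (_ : dual_map _ _ = omega (psi h)) ?wK ?psiK //.
  exact: linear_ext.
have := Kw (dual_map (dual_map psiL) z); set g := w _ => eg.
apply: linear_ext => m /=; rewrite /eval_at.
have /(congr1 (fun f : dual (dual G) => f (dual_map phi m))) := eg.
rewrite /= /eval_at /= => ->.
by congr (z _); apply: linear_ext => h /=; rewrite psiK.
Qed.

Lemma reflexive_dual (G : lmodType R) :
  reflexive_module G -> reflexive_module (dual G).
Proof.
case=> w wK Kw; exists (dual_map (@omega G)) => [m | z].
  exact: linear_ext.
apply: linear_ext => y; rewrite /= /eval_at -[y]Kw /=.
by [].
Qed.

End Reflexive.

(* [restr f M] is a copy of [M] because a type carries at most one canonical
   [lmodType] structure. *)
Definition restr (A B : pzRingType) (f : {rmorphism A -> B}) (M : lmodType B) :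
  Type := M.

Section Restriction.
Variables (A B : pzRingType) (f : {rmorphism A -> B}).

HB.instance Definition _ (M : lmodType B) := GRing.Zmodule.on (restr f M).

Section RestrModule.
Variable M : lmodType B.
Definition restr_scale (a : A) (m : restr f M) : restr f M := f a *: (m : M).

Fact restr_scaleA a b m : restr_scale a (restr_scale b m) = restr_scale (a * b) m.
Proof. by rewrite /restr_scale rmorphM scalerA. Qed.
Fact restr_scale1 : left_id 1 restr_scale.
Proof. by move=> m; rewrite /restr_scale rmorph1 scale1r. Qed.
Fact restr_scaleDr : right_distributive restr_scale +%R.
Proof. by move=> a m n; apply: (scalerDr (f a) (m : M) n). Qed.
Fact restr_scaleDl m : {morph restr_scale^~ m : a b / a + b}.
Proof. by move=> a b; rewrite /restr_scale rmorphD scalerDl. Qed.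
HB.instance Definition _ := GRing.Zmodule_isLmodule.Build A (restr f M)
  restr_scaleA restr_scale1 restr_scaleDr restr_scaleDl.

Lemma restr_scaleE a (m : restr f M) : a *: m = (f a *: (m : M)) :> M.
Proof. by []. Qed.
End RestrModule.

Section RestrMap.
Variables (M N : lmodType B) (phi : {linear M -> N}).
Definition restr_fun (m : restr f M) : restr f N := phi m.
Fact restr_fun_is_linear : linear restr_fun.
Proof. by move=> a m n; apply: (linearP phi). Qed.
HB.instance Definition _ := GRing.isLinear.Build A (restr f M) (restr f N) *:%R
  restr_fun restr_fun_is_linear.
Definition restr_map : {linear restr f M -> restr f N} := restr_fun.
End RestrMap.


End Restriction.
Arguments restr_map {A B} f {M N} phi.

(* Elements of [skew_poly charRp] are the left normal forms
   [\sum_i a_i x^i], stored as the polynomial with coefficients [a_i]. *)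
Definition skew_poly (R : comNzRingType) (p : nat) (charRp : p \in [pchar R]) :
  predArgType := {poly R}.

Section SkewPolynomialRing.
Variables (R : comNzRingType) (p : nat) (charRp : p \in [pchar R]).

Local Notation S := (skew_poly charRp).

Fact frobD (a b : R) n : (a + b) ^+ (p ^ n) = a ^+ (p ^ n) + b ^+ (p ^ n).
Proof.
elim: n => [|n IHn]; first by rewrite expn0 !expr1.
by rewrite expnSr !exprM IHn -!(pFrobenius_autE charRp) rmorphD.
Qed.

(* The axioms on the action of [x] on a left module, [x (r v) = r^p (x v)], and
   on a right module, [(v r^p) x = (v x) r]. *)
Definition left_semilinear (V : lmodType R) (phi : V -> V) : Prop :=
  {morph phi : v w / v + w} /\ forall r v, phi (r *: v) = r ^+ p *: phi v.

Definition right_semilinear (V : lmodType R) (tau : V -> V) : Prop :=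
  {morph tau : v w / v + w} /\ forall r v, tau (r ^+ p *: v) = r *: tau v.

Section LeftAction.
Variables (V : lmodType R) (phi : V -> V).
Hypothesis phiP : left_semilinear phi.

Definition skew_lact (a : {poly R}) (v : V) : V :=
  \sum_(i < size a) a`_i *: iter i phi v.

Fact skew_lact_widen n (a : {poly R}) v : (size a <= n)%N ->
  skew_lact a v = \sum_(i < n) a`_i *: iter i phi v.
Proof.
move=> le_an; rewrite /skew_lact (big_ord_widen n (fun i => a`_i *: iter i phi v)) //.
rewrite big_mkcond; apply: eq_bigr => i _; case: ltnP => // le_ai.
by rewrite nth_default ?scale0r.
Qed.

Fact skew_lactDl v : {morph skew_lact^~ v : a b / a + b}.
Proof.
move=> a b; pose n := maxn (size a) (size b).
rewrite !(@skew_lact_widen n) ?leq_maxl ?leq_maxr ?size_polyD // -big_split /=.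
by apply: eq_bigr => i _; rewrite coefD scalerDl.
Qed.

Fact iter_leftD n : {morph iter n phi : v w / v + w}.
Proof. by elim: n => [|n IHn] v w //=; rewrite IHn phiP.1. Qed.

Fact iter_left0 n : iter n phi 0 = 0.
Proof. by apply: (addIr (iter n phi 0)); rewrite -iter_leftD !add0r. Qed.

Fact iter_leftZ n r v : iter n phi (r *: v) = r ^+ (p ^ n) *: iter n phi v.
Proof.
by elim: n => [|n IHn] /=; rewrite ?expr1 // IHn phiP.2 -exprM expnSr.
Qed.

Fact skew_lactDr a : {morph skew_lact a : v w / v + w}.
Proof.
move=> v w; rewrite /skew_lact -big_split; apply: eq_bigr => i _ /=.
by rewrite iter_leftD scalerDr.
Qed.

Fact skew_lact0 v : skew_lact 0 v = 0.
Proof. by rewrite /skew_lact size_poly0 big_ord0. Qed.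

Fact skew_lact_monom r n v : skew_lact (r *: 'X^n) v = r *: iter n phi v.
Proof.
rewrite (@skew_lact_widen n.+1); last first.
  by rewrite (leq_trans (size_scale_leq _ _)) ?size_polyXn.
rewrite big_ord_recr /= big1 ?add0r => [|i _].
  by rewrite coefZ coefXn eqxx mulr1.
by rewrite coefZ coefXn ltn_eqF ?mulr0 ?scale0r.
Qed.

Fact skew_lactC r v : skew_lact r%:P v = r *: v.
Proof. by rewrite -[r%:P]mulr1 -[1]/'X^0 mul_polyC skew_lact_monom. Qed.

Fact skew_lactX v : skew_lact 'X v = phi v.
Proof. by rewrite -['X]scale1r -['X]expr1 skew_lact_monom scale1r. Qed.

End LeftAction.

Section RightAction.
Variables (V : lmodType R) (tau : V -> V).
Hypothesis tauP : right_semilinear tau.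

Definition skew_ract (a : {poly R}) (v : V) : V :=
  \sum_(i < size a) iter i tau (a`_i *: v).

Fact iter_rightD n : {morph iter n tau : v w / v + w}.
Proof. by elim: n => [|n IHn] v w //=; rewrite IHn tauP.1. Qed.

Fact iter_right0 n : iter n tau 0 = 0.
Proof. by apply: (addIr (iter n tau 0)); rewrite -iter_rightD !add0r. Qed.

Fact iter_rightZ n r v : iter n tau (r ^+ (p ^ n) *: v) = r *: iter n tau v.
Proof.
elim: n r => [|n IHn] r /=; rewrite ?expr1 //.
by rewrite expnS exprM IHn tauP.2.
Qed.

Fact skew_ract_widen n (a : {poly R}) v : (size a <= n)%N ->
  skew_ract a v = \sum_(i < n) iter i tau (a`_i *: v).
Proof.
move=> le_an; rewrite /skew_ract (big_ord_widen n (fun i => iter i tau (a`_i *: v))) //.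
rewrite big_mkcond; apply: eq_bigr => i _; case: ltnP => // le_ai.
by rewrite nth_default ?scale0r ?iter_right0.
Qed.

Fact skew_ractDl v : {morph skew_ract^~ v : a b / a + b}.
Proof.
move=> a b; pose n := maxn (size a) (size b).
rewrite !(@skew_ract_widen n) ?leq_maxl ?leq_maxr ?size_polyD // -big_split /=.
by apply: eq_bigr => i _; rewrite coefD scalerDl iter_rightD.
Qed.

Fact skew_ractDr a : {morph skew_ract a : v w / v + w}.
Proof.
move=> v w; rewrite /skew_ract -big_split; apply: eq_bigr => i _ /=.
by rewrite scalerDr iter_rightD.
Qed.

Fact skew_ract0 v : skew_ract 0 v = 0.
Proof. by rewrite /skew_ract size_poly0 big_ord0. Qed.

Fact skew_ract_monom r n v : skew_ract (r *: 'X^n) v = iter n tau (r *: v).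
Proof.
rewrite (@skew_ract_widen n.+1); last first.
  by rewrite (leq_trans (size_scale_leq _ _)) ?size_polyXn.
rewrite big_ord_recr /= big1 ?add0r => [|i _].
  by rewrite coefZ coefXn eqxx mulr1.
by rewrite coefZ coefXn ltn_eqF ?mulr0 ?scale0r ?iter_right0.
Qed.

Fact skew_ractC r v : skew_ract r%:P v = r *: v.
Proof. by rewrite -[r%:P]mulr1 -[1]/'X^0 mul_polyC skew_ract_monom. Qed.

Fact skew_ractX v : skew_ract 'X v = tau v.
Proof. by rewrite -['X]scale1r -['X]expr1 skew_ract_monom scale1r. Qed.

End RightAction.

(* [x r = r^p x] forces [(a x^i) (b x^j) = a b^(p^i) x^(i+j)]. *)
Definition skew_mul (a b : {poly R}) : {poly R} :=
  \sum_(i < size a) \sum_(j < size b)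
    (a`_i * b`_j ^+ (p ^ i)) *: 'X^(i + j).

Fact skew_lactM (V : lmodType R) (phi : V -> V) a b v : left_semilinear phi ->
  skew_lact phi (skew_mul a b) v = skew_lact phi a (skew_lact phi b v).
Proof.
move=> phiP; rewrite /skew_mul.
rewrite (big_morph _ (skew_lactDl phi v) (skew_lact0 phi v)).
rewrite [RHS]/skew_lact; apply: eq_bigr => i _.
rewrite (big_morph _ (skew_lactDl phi v) (skew_lact0 phi v)).
rewrite [skew_lact phi b v]/skew_lact.
rewrite (big_morph _ (iter_leftD phiP i) (iter_left0 phiP i)) scaler_sumr.
apply: eq_bigr => j _; rewrite skew_lact_monom iter_leftZ //.
by rewrite scalerA iterD.
Qed.

Fact skew_ractM (V : lmodType R) (tau : V -> V) a b v : right_semilinear tau ->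
  skew_ract tau (skew_mul a b) v = skew_ract tau b (skew_ract tau a v).
Proof.
move=> tauP; rewrite /skew_mul.
rewrite (big_morph _ (skew_ractDl tauP v) (skew_ract0 tau v)).
rewrite [skew_ract tau a v]/skew_ract.
rewrite (big_morph _ (skew_ractDr tauP b) (_ : _ 0 = 0)); last first.
  by apply: (addIr (skew_ract tau b 0)); rewrite -skew_ractDr // !add0r.
apply: eq_bigr => i _.
rewrite (big_morph _ (skew_ractDl tauP v) (skew_ract0 tau v)).
rewrite [RHS]/skew_ract; apply: eq_bigr => j _.
rewrite skew_ract_monom // -iter_rightZ // addnC iterD.
by rewrite scalerA mulrC.
Qed.

Definition skew_shift (b : {poly R}) : {poly R} :=
  map_poly (pFrobenius_aut charRp) b * 'X.

Fact skew_shift_semilinear : left_semilinear skew_shift.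
Proof.
rewrite /skew_shift; split => [b c | r b]; first by rewrite rmorphD mulrDl.
by rewrite map_polyZ -scalerAl.
Qed.

Fact skew_mulE a b : skew_mul a b = skew_lact skew_shift a b.
Proof.
rewrite /skew_mul /skew_lact; apply: eq_bigr => i _.
have shiftP := skew_shift_semilinear.
have -> : iter i skew_shift b = \sum_(j < size b) b`_j ^+ (p ^ i) *: 'X^(i + j).
  rewrite -[b in LHS]coefK poly_def.
  rewrite (big_morph _ (iter_leftD shiftP i) (iter_left0 shiftP i)).
  apply: eq_bigr => j _; rewrite iter_leftZ //; congr (_ *: _).
  elim: (nat_of_ord i) => // n IHn.
  by rewrite addSn iterS IHn /skew_shift map_polyXn exprSr.
by rewrite scaler_sumr; apply: eq_bigr => j _; rewrite scalerA.
Qed.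

HB.instance Definition _ := GRing.Zmodule.on S.

Fact skew_mulA : associative (skew_mul : S -> S -> S).
Proof.
move=> a b c; rewrite ![skew_mul _ c]skew_mulE skew_mulE skew_lactM //.
exact: skew_shift_semilinear.
Qed.
Fact skew_mul1 : left_id (1 : {poly R}) (skew_mul : S -> S -> S).
Proof.
by move=> a; rewrite skew_mulE -[1]/(1%:P) skew_lactC scale1r.
Qed.
Fact skew_mulr1 : right_id (1 : {poly R}) (skew_mul : S -> S -> S).
Proof.
move=> a; rewrite /skew_mul size_poly1 -[RHS]coefK poly_def.
apply: eq_bigr => i _; rewrite big_ord1 coefC /= expr1n mulr1.
by rewrite addn0.
Qed.
Fact skew_mulDl : left_distributive (skew_mul : S -> S -> S) +%R.
Proof. by move=> a b c; rewrite !skew_mulE skew_lactDl. Qed.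
Fact skew_mulDr : right_distributive (skew_mul : S -> S -> S) +%R.
Proof.
move=> a b c; rewrite !skew_mulE skew_lactDr //; exact: skew_shift_semilinear.
Qed.
Fact skew_one_neq0 : (1 : {poly R}) != (0 : S).
Proof. exact: oner_neq0. Qed.

HB.instance Definition _ := GRing.Zmodule_isNzRing.Build S
  skew_mulA skew_mul1 skew_mulr1 skew_mulDl skew_mulDr skew_one_neq0.

Definition skewX : S := 'X.
Definition skewC (r : R) : S := r%:P.

Fact skewC_is_zmod_morphism : zmod_morphism skewC.
Proof. by move=> a b; rewrite /skewC polyCB. Qed.
Fact skewC_is_monoid_morphism : monoid_morphism skewC.
Proof.
split=> // a b; rewrite /skewC -[RHS]/(skew_mul a%:P b%:P) skew_mulE.
by rewrite skew_lactC polyCM mul_polyC.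
Qed.
HB.instance Definition _ :=
  GRing.isZmodMorphism.Build R S skewC skewC_is_zmod_morphism.
HB.instance Definition _ :=
  GRing.isMonoidMorphism.Build R S skewC skewC_is_monoid_morphism.

Lemma skewXC r : skewX * skewC r = skewC (r ^+ p) * skewX.
Proof.
rewrite -[LHS]/(skew_mul 'X r%:P) -[RHS]/(skew_mul (r ^+ p)%:P 'X) !skew_mulE.
by rewrite skew_lactX skew_lactC /skew_shift map_polyC /= mul_polyC.
Qed.

Lemma skew_polyE (a : S) :
  a = \sum_(i < size (a : {poly R})) skewC (a : {poly R})`_i * skewX ^+ i.
Proof.
have skewXn n : skewX ^+ n = 'X^n :> {poly R}.
  elim: n => // n IHn; rewrite exprS -[LHS]/(skew_mul 'X (skewX ^+ n)) IHn.
  by rewrite skew_mulE skew_lactX /skew_shift map_polyXn exprSr.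
rewrite -[LHS]coefK poly_def; apply: eq_bigr => i _.
by rewrite -[RHS]/(skew_mul _ _) skew_mulE skew_lactC skewXn.
Qed.

(* Since [R] is commutative, [skewC] is also a ring morphism to the converse
   ring [S^c]; right [S]-modules are left modules over [S^c]. *)
Definition skewCr (r : R) : S^c := skewC r.
Definition skewXr : S^c := skewX.

Fact skewCr_is_zmod_morphism : zmod_morphism skewCr.
Proof. exact: skewC_is_zmod_morphism. Qed.
Fact skewCr_is_monoid_morphism : monoid_morphism skewCr.
Proof.
split=> // a b; rewrite /skewCr mulrC.
exact: (skewC_is_monoid_morphism.2 b a).
Qed.
HB.instance Definition _ :=
  GRing.isZmodMorphism.Build R S^c skewCr skewCr_is_zmod_morphism.
HB.instance Definition _ :=
  GRing.isMonoidMorphism.Build R S^c skewCr skewCr_is_monoid_morphism.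

Lemma skewXCr r : skewXr * skewCr (r ^+ p) = skewCr r * skewXr.
Proof. exact: esym (skewXC r). Qed.

(* Copies of [V] made into a left (resp. right) skew polynomial module in which
   [x] acts by [phi] (resp. [tau]); the formulas are [skew_lact], [skew_ract]. *)
Definition left_skew (V : lmodType R) (phi : V -> V)
  (phiP : left_semilinear phi) : Type := V.

Definition right_skew (V : lmodType R) (tau : V -> V)
  (tauP : right_semilinear tau) : Type := V.

Section LeftSkewModule.
Variables (V : lmodType R) (phi : V -> V) (phiP : left_semilinear phi).
Local Notation L := (left_skew phiP).
HB.instance Definition _ := GRing.Zmodule.on L.

Fact left_skew_scaleA (a b : S) (v : L) :
  skew_lact phi a (skew_lact phi b v) = skew_lact phi (a * b) v.
Proof. by rewrite -skew_lactM. Qed.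
Fact left_skew_scale1 : left_id (1 : S) (skew_lact phi : S -> L -> L).
Proof. by move=> v; rewrite -[1]/(1%:P) skew_lactC scale1r. Qed.
Fact left_skew_scaleDr :
  right_distributive (skew_lact phi : S -> L -> L) +%R.
Proof. exact: skew_lactDr. Qed.
Fact left_skew_scaleDl (v : L) :
  {morph (fun a : S => skew_lact phi a v : L) : a b / a + b}.
Proof. exact: skew_lactDl. Qed.
HB.instance Definition _ := GRing.Zmodule_isLmodule.Build S L
  left_skew_scaleA left_skew_scale1 left_skew_scaleDr left_skew_scaleDl.

Lemma left_skewX (v : L) : skewX *: v = phi v.
Proof. exact: skew_lactX. Qed.
Lemma left_skewC r (v : L) : skewC r *: v = r *: (v : V).
Proof. exact: skew_lactC. Qed.
End LeftSkewModule.

Section RightSkewModule.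
Variables (V : lmodType R) (tau : V -> V) (tauP : right_semilinear tau).
Local Notation M := (right_skew tauP).
HB.instance Definition _ := GRing.Zmodule.on M.

Fact right_skew_scaleA (a b : S^c) (v : M) :
  skew_ract tau a (skew_ract tau b v) = skew_ract tau (a * b) v.
Proof. by rewrite -skew_ractM. Qed.
Fact right_skew_scale1 : left_id (1 : S^c) (skew_ract tau : S^c -> M -> M).
Proof. by move=> v; rewrite -[1]/(1%:P) skew_ractC ?scale1r. Qed.
Fact right_skew_scaleDr :
  right_distributive (skew_ract tau : S^c -> M -> M) +%R.
Proof. exact: skew_ractDr. Qed.
Fact right_skew_scaleDl (v : M) :
  {morph (fun a : S^c => skew_ract tau a v : M) : a b / a + b}.
Proof. exact: skew_ractDl. Qed.
HB.instance Definition _ := GRing.Zmodule_isLmodule.Build S^c M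
  right_skew_scaleA right_skew_scale1 right_skew_scaleDr right_skew_scaleDl.

Lemma right_skewX (v : M) : skewXr *: v = tau v.
Proof. exact: skew_ractX. Qed.
Lemma right_skewC r (v : M) : skewCr r *: v = r *: (v : V).
Proof. exact: skew_ractC. Qed.
End RightSkewModule.

(* A map of skew polynomial modules is linear as soon as it commutes with
   scalars and with [x]. *)
Lemma left_linearP (H K : lmodType S) (f : H -> K) :
  {morph f : h k / h + k} -> (forall r h, f (skewC r *: h) = skewC r *: f h) ->
  (forall h, f (skewX *: h) = skewX *: f h) -> linear f.
Proof.
move=> fD fC fX.
have fX' n h : f (skewX ^+ n *: h) = skewX ^+ n *: f h.
  elim: n h => [|n IHn] h; first by rewrite !expr0 !scale1r.
  by rewrite exprS -!scalerA fX IHn.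
have f0 : f 0 = 0 by apply: (addIr (f 0)); rewrite -fD !add0r.
move=> a h k; rewrite fD; congr (_ + _); rewrite [a]skew_polyE !scaler_suml.
by rewrite (big_morph _ fD f0); apply: eq_bigr => i _; rewrite -!scalerA fC fX'.
Qed.

Lemma right_linearP (M N : lmodType S^c) (f : M -> N) :
  {morph f : m n / m + n} ->
  (forall r m, f (skewCr r *: m) = skewCr r *: f m) ->
  (forall m, f (skewXr *: m) = skewXr *: f m) -> linear f.
Proof.
move=> fD fC fX.
have fX' n m : f ((skewXr ^+ n) *: m) = skewXr ^+ n *: f m.
  elim: n m => [|n IHn] m; first by rewrite !expr0 !scale1r.
  by rewrite exprS -!scalerA fX IHn.
have f0 : f 0 = 0 by apply: (addIr (f 0)); rewrite -fD !add0r.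
have Xn n : skewXr ^+ n = skewX ^+ n :> S.
  by elim: n => // n IHn; rewrite exprS exprSr -IHn.
move=> a m n; rewrite fD; congr (_ + _).
have -> : a = \sum_(i < size (a : {poly R}))
    skewXr ^+ i * skewCr (a : {poly R})`_i.
  by rewrite [LHS](skew_polyE a); apply: eq_bigr => i _; rewrite -Xn.
rewrite !scaler_suml (big_morph _ fD f0).
by apply: eq_bigr => i _; rewrite -!scalerA fX' fC.
Qed.

End SkewPolynomialRing.

Record bimodule (A B : pzRingType) := Bimodule {
  bim_sort :> zmodType;
  lact : A -> bim_sort -> bim_sort;
  ract : bim_sort -> B -> bim_sort;
  lactDr : forall a, {morph lact a : m n / m + n};
  lactDl : forall m, {morph lact^~ m : a b / a + b};
  lactM : forall a b m, lact (a * b) m = lact a (lact b m);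
  lact1 : forall m, lact 1 m = m;
  ractDl : forall b, {morph ract^~ b : m n / m + n};
  ractDr : forall m, {morph ract m : a b / a + b};
  ractM : forall a b m, ract m (a * b) = ract (ract m a) b;
  ract1 : forall m, ract m 1 = m;
  lractA : forall a m b, ract (lact a m) b = lact a (ract m b)
}.

(* The two-sided inverse is part of the data; it is determined by [bim_fun]. *)
Record bimod_iso (A B : pzRingType) (M N : bimodule A B) := BimodIso {
  bim_fun :> M -> N;
  bim_inv : N -> M;
  bim_funK : cancel bim_fun bim_inv;
  bim_invK : cancel bim_inv bim_fun;
  bim_funD : {morph bim_fun : m n / m + n};
  bim_funl : forall a m, bim_fun (lact a m) = lact a (bim_fun m);
  bim_funr : forall m b, bim_fun (ract m b) = ract (bim_fun m) b
}.

(* [Hom_r M N] is the group of homomorphisms of right [B]-modules from [M] to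
   [N], with [(c f a) m = c (f (a m))]. *)
Section RightHom.
Variables (A B C : pzRingType) (M : bimodule A B) (N : bimodule C B).

Record right_hom := RightHom {
  rhom_fun :> M -> N;
  rhomD : {morph rhom_fun : m n / m + n};
  rhomZ : forall m b, rhom_fun (ract m b) = ract (rhom_fun m) b
}.

Lemma right_hom_ext (f g : right_hom) : f =1 g -> f = g.
Proof.
case: f => f fD fZ; case: g => g gD gZ /= /funext e.
case: _ / e in gD gZ *.
by rewrite (Prop_irrelevance fD gD) (Prop_irrelevance fZ gZ).
Qed.

HB.instance Definition _ := gen_eqMixin right_hom.
HB.instance Definition _ := gen_choiceMixin right_hom.

Fact ract0l b : ract (0 : N) b = 0.
Proof. by apply: (addIr (ract 0 b)); rewrite -ractDl !add0r. Qed.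
Fact lact0r c : lact c (0 : N) = 0.
Proof. by apply: (addIr (lact c 0)); rewrite -lactDr !add0r. Qed.
Fact ractNl (n : N) b : ract (- n) b = - ract n b.
Proof. by apply: (addIr (ract n b)); rewrite -ractDl !addNr ract0l. Qed.

Program Definition rhom_zero := @RightHom (fun=> 0) _ _.
Next Obligation. by move=> m n; rewrite addr0. Qed.
Next Obligation. by rewrite ract0l. Qed.
Program Definition rhom_opp (f : right_hom) := @RightHom (fun m => - f m) _ _.
Next Obligation. by move=> m n; rewrite rhomD opprD. Qed.
Next Obligation. by rewrite rhomZ ractNl. Qed.
Program Definition rhom_add (f g : right_hom) :=
  @RightHom (fun m => f m + g m) _ _.
Next Obligation. by move=> m n; rewrite !rhomD addrACA. Qed.
Next Obligation. by rewrite !rhomZ ractDl. Qed.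

Fact rhom_addA : associative rhom_add.
Proof. by move=> f g h; apply: right_hom_ext => m /=; rewrite addrA. Qed.
Fact rhom_addC : commutative rhom_add.
Proof. by move=> f g; apply: right_hom_ext => m /=; rewrite addrC. Qed.
Fact rhom_add0 : left_id rhom_zero rhom_add.
Proof. by move=> f; apply: right_hom_ext => m /=; rewrite add0r. Qed.
Fact rhom_addN : left_inverse rhom_zero rhom_opp rhom_add.
Proof. by move=> f; apply: right_hom_ext => m /=; rewrite addNr. Qed.
HB.instance Definition _ := GRing.isZmodule.Build right_hom
  rhom_addA rhom_addC rhom_add0 rhom_addN.

Program Definition rhom_lact (c : C) (f : right_hom) :=
  @RightHom (fun m => lact c (f m)) _ _.
Next Obligation. by move=> m n; rewrite rhomD lactDr. Qed.
Next Obligation. by rewrite rhomZ lractA. Qed.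
Program Definition rhom_ract (f : right_hom) (a : A) :=
  @RightHom (fun m => f (lact a m)) _ _.
Next Obligation. by move=> m n; rewrite lactDr rhomD. Qed.
Next Obligation. by rewrite -lractA rhomZ. Qed.

Program Definition Hom_r : bimodule C A :=
  @Bimodule C A right_hom rhom_lact rhom_ract _ _ _ _ _ _ _ _ _.
Next Obligation. by move=> f g; apply: right_hom_ext => m /=; rewrite lactDr. Qed.
Next Obligation. by move=> a b; apply: right_hom_ext => n /=; rewrite lactDl. Qed.
Next Obligation. by apply: right_hom_ext => n /=; rewrite lactM. Qed.
Next Obligation. by apply: right_hom_ext => n /=; rewrite lact1. Qed.
Next Obligation. by move=> f g; apply: right_hom_ext. Qed.
Next Obligation.
by move=> a b; apply: right_hom_ext => n /=; rewrite lactDl rhomD.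
Qed.
Next Obligation. by apply: right_hom_ext => n /=; rewrite lactM. Qed.
Next Obligation. by apply: right_hom_ext => n /=; rewrite lact1. Qed.
Next Obligation. exact: right_hom_ext. Qed.
End RightHom.

Section FrobeniusBimodules.
Variables (R : comNzRingType) (p : nat) (charRp : p \in [pchar R]).
Variable I : lmodType R.

Program Definition sym_bimod : bimodule R R :=
  @Bimodule R R I (fun r z => r *: z) (fun z s => s *: z) _ _ _ _ _ _ _ _ _.
Next Obligation. by move=> z w; rewrite scalerDr. Qed.
Next Obligation. by move=> a b; rewrite scalerDl. Qed.
Next Obligation. by rewrite scalerA. Qed.
Next Obligation. by rewrite scale1r. Qed.
Next Obligation. by move=> z w; rewrite scalerDr. Qed.
Next Obligation. by move=> a b; rewrite scalerDl. Qed.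
Next Obligation. by rewrite scalerA mulrC. Qed.
Next Obligation. by rewrite scale1r. Qed.
Next Obligation. by rewrite !scalerA mulrC. Qed.

Program Definition R_f : bimodule R R :=
  @Bimodule R R R (fun r m => r * m) (fun m s => m * s ^+ p) _ _ _ _ _ _ _ _ _.
Next Obligation. by move=> m n; rewrite mulrDr. Qed.
Next Obligation. by move=> a b; rewrite mulrDl. Qed.
Next Obligation. by rewrite mulrA. Qed.
Next Obligation. by rewrite mul1r. Qed.
Next Obligation. by move=> m n; rewrite mulrDl. Qed.
Next Obligation.
by move=> a b; rewrite -!(pFrobenius_autE charRp) rmorphD mulrDr.
Qed.
Next Obligation. by rewrite exprMn mulrA. Qed.
Next Obligation. by rewrite expr1n mulr1. Qed.
Next Obligation. by rewrite mulrA. Qed.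

Program Definition f_I : bimodule R R :=
  @Bimodule R R I (fun r z => r ^+ p *: z) (fun z s => s *: z)
    _ _ _ _ _ _ _ _ _.
Next Obligation. by move=> z w; rewrite scalerDr. Qed.
Next Obligation.
by move=> a b; rewrite -!(pFrobenius_autE charRp) rmorphD scalerDl.
Qed.
Next Obligation. by rewrite scalerA exprMn. Qed.
Next Obligation. by rewrite expr1n scale1r. Qed.
Next Obligation. by move=> z w; rewrite scalerDr. Qed.
Next Obligation. by move=> a b; rewrite scalerDl. Qed.
Next Obligation. by rewrite scalerA mulrC. Qed.
Next Obligation. by rewrite scale1r. Qed.
Next Obligation. by rewrite !scalerA mulrC. Qed.
End FrobeniusBimodules.

Record category := Category {
  cat_obj :> Type;
  cat_hom : cat_obj -> cat_obj -> Type;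
  cat_id : forall a, cat_hom a a;
  cat_comp : forall a b c, cat_hom b c -> cat_hom a b -> cat_hom a c;
  cat_comp1m : forall a b (u : cat_hom a b), cat_comp (cat_id b) u = u;
  cat_compm1 : forall a b (u : cat_hom a b), cat_comp u (cat_id a) = u;
  cat_compA : forall a b c d (w : cat_hom c d) (v : cat_hom b c) (u : cat_hom a b),
    cat_comp w (cat_comp v u) = cat_comp (cat_comp w v) u
}.

Definition opposite (C : category) : category :=
  @Category C (fun a b => cat_hom b a) (@cat_id C) (fun a b c v u => cat_comp u v)
    (fun a b u => cat_compm1 u) (fun a b u => cat_comp1m u)
    (fun a b c d w v u => esym (cat_compA u v w)).

Record functor (C E : category) := Functor {
  fobj :> C -> E;
  fmap : forall a b, cat_hom a b -> cat_hom (fobj a) (fobj b);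
  fmap1 : forall a, fmap (cat_id a) = cat_id (fobj a);
  fmapM : forall a b c (v : cat_hom b c) (u : cat_hom a b),
    fmap (cat_comp v u) = cat_comp (fmap v) (fmap u)
}.

Definition id_functor (C : category) : functor C C :=
  @Functor C C id (fun a b u => u) (fun=> erefl) (fun a b c v u => erefl).

Program Definition comp_functor (C E F : category)
    (Q : functor E F) (P : functor C E) : functor C F :=
  @Functor C F (fun a => Q (P a)) (fun a b u => fmap Q (fmap P u)) _ _.
Next Obligation. by rewrite !fmap1. Qed.
Next Obligation. by rewrite !fmapM. Qed.

(* A functor [C -> opposite E] is the same thing as a functor [opposite C -> E]. *)
Definition flip_functor (C E : category) (P : functor C (opposite E)) : functor (opposite C) E :=
  @Functor (opposite C) E (fobj P) (fun a b (u : @cat_hom (opposite C) a b) => @fmap _ _ P b a u)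
    (@fmap1 _ _ P) (fun a b c v u => @fmapM _ _ P c b a u v).

Definition is_iso (C : category) (a b : C) (u : cat_hom a b) : Prop :=
  exists v : cat_hom b a, cat_comp v u = cat_id a /\ cat_comp u v = cat_id b.

Definition naturally_isomorphic (C E : category) (P Q : functor C E) : Prop :=
  exists eta : forall a, cat_hom (P a) (Q a),
    (forall a, is_iso (eta a)) /\
    (forall a b (u : cat_hom a b),
        cat_comp (eta b) (fmap P u) = cat_comp (fmap Q u) (eta a)).

Definition inverse_equivalences (C E : category)
    (P : functor C E) (Q : functor E C) : Prop :=
  naturally_isomorphic (comp_functor Q P) (id_functor C) /\
  naturally_isomorphic (comp_functor P Q) (id_functor E).

Program Definition full_subcategory (C : category) (p : C -> Prop) : category :=
  @Category {a : C | p a} (fun a b => cat_hom (sval a) (sval b))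
    (fun a => cat_id (sval a)) (fun a b c v u => cat_comp v u) _ _ _.
Next Obligation. exact: cat_comp1m. Qed.
Next Obligation. exact: cat_compm1. Qed.
Next Obligation. exact: cat_compA. Qed.

Definition restrict_contra (C E : category) (p : C -> Prop) (q : E -> Prop)
    (P : functor C (opposite E)) (pq : forall a, p a -> q (P a)) :
    functor (full_subcategory p) (opposite (full_subcategory q)) :=
  @Functor (full_subcategory p) (opposite (full_subcategory q))
    (fun a => exist q (P (sval a)) (pq _ (svalP a)))
    (fun a b (u : cat_hom (sval a) (sval b)) => fmap P u)
    (fun a => fmap1 P (sval a))
    (fun a b c v u => @fmapM _ _ P (sval a) (sval b) (sval c) v u).

Section ModuleCategory.
Variable A : pzRingType.
Program Definition module_category : category :=
  @Category (lmodType A) (fun M N => {linear M -> N})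
    (fun M => idfun : {linear M -> M})
    (fun L M N v u => v \o u : {linear L -> N}) _ _ _.
Next Obligation. exact: linear_ext. Qed.
Next Obligation. exact: linear_ext. Qed.
Next Obligation. exact: linear_ext. Qed.
End ModuleCategory.

Section Duality.
Variables (R : comNzRingType) (p : nat) (charRp : p \in [pchar R]).
Variable I : lmodType R.
Variable Psi : bimod_iso (f_I charRp I) (Hom_r (R_f charRp) (sym_bimod I)).

Local Notation S := (skew_poly charRp).
Local Notation resl H := (restr (skewC charRp) H).
Local Notation resr M := (restr (skewCr charRp) M).

Fact PsiZ r z (t : R_f charRp) : Psi (r *: z) t = Psi z (r * t).
Proof. by rewrite (bim_funr Psi z r : Psi _ = _). Qed.

Fact PsiF r z (t : R_f charRp) : Psi (r ^+ p *: z) t = r *: Psi z t.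
Proof. by rewrite (bim_funl Psi r z : Psi _ = _). Qed.

Fact PsiD z w (t : R_f charRp) : Psi (z + w) t = Psi z t + Psi w t.
Proof. by rewrite (bim_funD Psi z w : Psi _ = _). Qed.

Section DObject.
Variable H : lmodType S.

(* [(m x)(h) = (Psi (m (x h))) 1] *)
Definition D_fun (m : dual I (resl H)) (h : resl H) : I :=
  Psi (m (skewX charRp *: (h : H))) (1 : R).

Fact D_fun_is_linear m : linear (D_fun m).
Proof.
move=> r h k; rewrite /D_fun.
have -> : skewX charRp *: ((r *: h + k : resl H) : H) =
    (r ^+ p *: (skewX charRp *: (h : H) : resl H)
      + (skewX charRp *: (k : H) : resl H)) :> resl H.
  rewrite [LHS](scalerDr (s := H)); congr (_ + _).
  by rewrite !restr_scaleE !scalerA skewXC.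
by rewrite linearP PsiD PsiF.
Qed.
HB.instance Definition _ m :=
  GRing.isLinear.Build R (resl H) I *:%R (D_fun m) (D_fun_is_linear m).

Definition D_x (m : dual I (resl H)) : dual I (resl H) :=
  D_fun m : {linear resl H -> I}.

Fact D_x_semilinear : right_semilinear p D_x.
Proof.
split=> [m n | r m]; apply: linear_ext => h /=; rewrite /D_fun.
  exact: PsiD.
exact: PsiF.
Qed.

Definition D_obj : lmodType S^c := right_skew D_x_semilinear.
End DObject.

Section DMorphism.
Variables (H K : lmodType S) (phi : {linear H -> K}).

Definition D_map (m : D_obj K) : D_obj H :=
  dual_map (restr_map (skewC charRp) phi) m.

Fact D_map_is_linear : linear D_map.
Proof.
apply: right_linearP => [m n | r m | m].
- exact: linear_ext.
- by rewrite /D_map !right_skewC; exact: linear_ext.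
rewrite /D_map !right_skewX; apply: linear_ext => h /=.
by rewrite /D_fun /= /restr_fun linearZ.
Qed.
HB.instance Definition _ := GRing.isLinear.Build S^c (D_obj K) (D_obj H) *:%R
  D_map D_map_is_linear.
End DMorphism.

Program Definition functor_D :
    functor (module_category S) (opposite (module_category S^c)) :=
  @Functor (module_category S) (opposite (module_category S^c)) D_obj
    (fun H K (phi : {linear H -> K}) => D_map phi : {linear D_obj K -> D_obj H})
    _ _.
Next Obligation. by apply: linear_ext => m; apply: linear_ext. Qed.
Next Obligation. by apply: linear_ext => m; apply: linear_ext. Qed.

Section D'Object.
Variable M : lmodType S^c.

(* [r' |-> h ((m r') x)]; its preimage under [Psi], as a function of [m], is
   [x h]. *)
Definition D'_fun (h : dual I (resr M)) (m : resr M) : R_f charRp -> sym_bimod I :=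
  fun r' : R => h (skewXr charRp *: (r' *: m : resr M) : M).

Fact D'_funD h m : {morph D'_fun h m : r s / r + s}.
Proof.
by move=> r s; rewrite /D'_fun scalerDl (scalerDr (s := M)) (raddfD h).
Qed.

Fact D'_funZ h m r s : D'_fun h m (ract r s) = ract (D'_fun h m r) s.
Proof.
rewrite /D'_fun /= -linearZ; congr (h _); rewrite !restr_scaleE.
rewrite !scalerA mulrC rmorphM mulrA.
by rewrite skewXCr.
Qed.

Definition D'_hom h m : Hom_r (R_f charRp) (sym_bimod I) :=
  RightHom (D'_funD h m) (D'_funZ h m).

Definition D'_val (h : dual I (resr M)) (m : resr M) : I :=
  bim_inv Psi (D'_hom h m).

Fact D'_val_is_linear h : linear (D'_val h).
Proof.
move=> r m n; apply: (can_inj (bim_funK Psi)).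
apply: right_hom_ext => s; rewrite PsiD PsiZ !bim_invK /= /D'_fun.
by rewrite [s *: _]scalerDr [s *: (r *: m)]scalerA [s * r]mulrC (scalerDr (s := M)) (raddfD h).
Qed.
HB.instance Definition _ h :=
  GRing.isLinear.Build R (resr M) I *:%R (D'_val h) (D'_val_is_linear h).

Definition D'_x (h : dual I (resr M)) : dual I (resr M) :=
  D'_val h : {linear resr M -> I}.

Fact D'_x_semilinear : left_semilinear p D'_x.
Proof.
split=> [h k | r h]; apply: linear_ext => m; apply: (can_inj (bim_funK Psi)).
  apply: right_hom_ext => s /=.
  by rewrite /D'_val PsiD !bim_invK.
apply: right_hom_ext => s /=.
by rewrite /D'_val PsiF !bim_invK.
Qed.

Definition D'_obj : lmodType S := left_skew D'_x_semilinear.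
End D'Object.

Section D'Morphism.
Variables (M N : lmodType S^c) (psi : {linear M -> N}).

Definition D'_map (h : D'_obj N) : D'_obj M :=
  dual_map (restr_map (skewCr charRp) psi) h.

Fact D'_map_is_linear : linear D'_map.
Proof.
apply: left_linearP => [h k | r h | h].
- exact: linear_ext.
- by rewrite /D'_map !left_skewC; exact: linear_ext.
rewrite /D'_map !left_skewX; apply: linear_ext => m /=; rewrite /D'_val.
congr (bim_inv Psi _); apply: right_hom_ext => r /=; rewrite /D'_fun /=.
by rewrite /restr_fun !restr_scaleE !linearZ.
Qed.
HB.instance Definition _ := GRing.isLinear.Build S (D'_obj N) (D'_obj M) *:%R
  D'_map D'_map_is_linear.
End D'Morphism.

Program Definition functor_D' :
    functor (module_category S^c) (opposite (module_category S)) :=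
  @Functor (module_category S^c) (opposite (module_category S)) D'_obj
    (fun M N (psi : {linear M -> N}) => D'_map psi : {linear D'_obj N -> D'_obj M})
    _ _.
Next Obligation. by apply: linear_ext => m; apply: linear_ext. Qed.
Next Obligation. by apply: linear_ext => m; apply: linear_ext. Qed.

Definition reflexive_left (H : module_category S) : Prop :=
  reflexive_module I (resl H).
Definition reflexive_right (M : module_category S^c) : Prop :=
  reflexive_module I (resr M).

Definition L_I : category := full_subcategory reflexive_left.
Definition R_I : category := full_subcategory reflexive_right.

Fact D_reflexive H : reflexive_left H -> reflexive_right (functor_D H).
Proof.
move=> /reflexive_dual; have lin : linear (id : dual I (resl H) -> resr (D_obj H)).
  by move=> r m n; rewrite restr_scaleE right_skewC.
pose f : {linear dual I (resl H) -> resr (D_obj H)} :=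
  HB.pack (id : dual I (resl H) -> resr (D_obj H))
    (GRing.isLinear.Build R (dual I (resl H)) (resr (D_obj H)) *:%R _ lin).
by apply: (@reflexive_iso _ _ _ _ f); exists id.
Qed.

Fact D'_reflexive M : reflexive_right M -> reflexive_left (functor_D' M).
Proof.
move=> /reflexive_dual; have lin : linear (id : dual I (resr M) -> resl (D'_obj M)).
  by move=> r m n; rewrite restr_scaleE left_skewC.
pose f : {linear dual I (resr M) -> resl (D'_obj M)} :=
  HB.pack (id : dual I (resr M) -> resl (D'_obj M))
    (GRing.isLinear.Build R (dual I (resr M)) (resl (D'_obj M)) *:%R _ lin).
by apply: (@reflexive_iso _ _ _ _ f); exists id.
Qed.

Definition D : functor L_I (opposite R_I) := restrict_contra D_reflexive.
Definition D' : functor R_I (opposite L_I) := restrict_contra D'_reflexive.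

End Duality.

(* Main.v *)
(** Evaluation [h |-> (m |-> m h)] is a natural map [H -> D' (D H)], and
    likewise [M -> D (D' M)]; both are bijective on reflexive modules. They
    commute with [x] because [Psi z r = Psi (r z) 1], so that the [r]-th value
    of [Psi (m (x h))] is the value at [h] of [(m r) x]. *)

Require Import Defs.
From HB Require Import structures.
From mathcomp Require Import all_boot all_algebra.
From mathcomp Require Import boolp.

Set Implicit Arguments.
Unset Strict Implicit.
Unset Printing Implicit Defensive.

Import GRing.Theory.
Local Open Scope ring_scope.

(** Lets a unit from the identity to a composite, which is the direction of evaluation, serve where
    [inverse_equivalences] asks for a map out of the composite. *)
Lemma naturally_isomorphic_sym (C E : category) (P Q : functor C E) :
  naturally_isomorphic P Q -> naturally_isomorphic Q P.
Proof.
case=> eta [eta_iso eta_nat].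
pose theta a := sval (cid (eta_iso a)).
have thetaP a := svalP (cid (eta_iso a)).
exists theta; split=> [a | a b u].
  by exists (eta a); case: (thetaP a).
(* Insert [eta a] after [theta a] on the right, so that naturality of [eta] moves it across [u] to
   [eta b], which cancels against [theta b]. *)
rewrite -[LHS]cat_compm1 -(thetaP a).2 !cat_compA -(cat_compA (theta b)).
by rewrite -eta_nat !cat_compA (thetaP b).1 cat_comp1m.
Qed.

Lemma bijective_linear_iso (A : pzRingType) (M N : lmodType A)
    (f : {linear M -> N}) :
  bijective f -> @is_iso (module_category A) M N f.
Proof.
case=> g fK gK; have g_lin : linear g.
  by move=> a x y; apply: (can_inj fK); rewrite linearP !gK.
pose gL : {linear N -> M} :=
  HB.pack g (GRing.isLinear.Build A N M *:%R g g_lin).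
by exists gL; split; apply: linear_ext => x /=; rewrite ?fK ?gK.
Qed.

Section Biduality.
Variables (R : comNzRingType) (p : nat) (charRp : p \in [pchar R]).
Variable I : lmodType R.
Variable Psi : bimod_iso (f_I charRp I) (Hom_r (R_f charRp) (sym_bimod I)).

Local Notation S := (skew_poly charRp).
Local Notation resl H := (restr (skewC charRp) H).
Local Notation resr M := (restr (skewCr charRp) M).

(* [resr (D_obj Psi H)] and [dual I (resl H)] have the same carrier and the same
   scalar action, but the two actions are only provably equal; hence these
   evaluations are not instances of [omega]. *)
Section LeftBidual.
Variable H : lmodType S.

Definition dual_to_D : dual I (resl H) -> resr (D_obj Psi H) := id.
Fact dual_to_D_is_linear : linear dual_to_D.
Proof. by move=> r m n; rewrite restr_scaleE right_skewC. Qed.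
HB.instance Definition _ :=
  GRing.isLinear.Build R (dual I (resl H)) (resr (D_obj Psi H)) *:%R
    dual_to_D dual_to_D_is_linear.

Section At.
Variable h : H.
Definition left_eval_at (m : resr (D_obj Psi H)) : I := (m : dual I (resl H)) h.
Fact left_eval_at_is_linear : linear left_eval_at.
Proof.
by move=> r m n; rewrite /left_eval_at restr_scaleE right_skewC.
Qed.
HB.instance Definition _ :=
  GRing.isLinear.Build R (resr (D_obj Psi H)) I *:%R
    left_eval_at left_eval_at_is_linear.
End At.

Definition left_eval (h : H) : D'_obj Psi (D_obj Psi H) :=
  left_eval_at h : {linear resr (D_obj Psi H) -> I}.

Fact left_eval_is_linear : linear left_eval.
Proof.
apply: left_linearP => [h k | r h | h].
- by apply: linear_ext => m; exact: (raddfD (m : dual I (resl H))).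
- rewrite left_skewC; apply: linear_ext => m.
  exact: (linearZ_LR (m : dual I (resl H)) r (h : resl H)).
(* In the double dual [x] acts through [bim_inv Psi], so the two values are compared after applying
   the injective [Psi], at each [r]. *)
rewrite left_skewX; apply: linear_ext => m; apply: (can_inj (bim_funK Psi)).
apply: right_hom_ext => r; rewrite /= /D'_val bim_invK /= /D'_fun.
rewrite /left_eval_at right_skewX /= /D_fun restr_scaleE right_skewC.
by rewrite lin_scaleE PsiZ mulr1.
Qed.
HB.instance Definition _ :=
  GRing.isLinear.Build S H (D'_obj Psi (D_obj Psi H)) *:%R
    left_eval left_eval_is_linear.

(** Pulling [z] back along [dual_to_D] gives an element of the double dual over [R], where the
    inverse of [omega] applies. *)
Lemma left_eval_bijective : reflexive_left I H -> bijective left_eval.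
Proof.
case=> w wK Kw; exists (fun z => w (dual_map dual_to_D z)) => [h | z].
  by rewrite -[RHS]wK; congr (w _); apply: linear_ext.
apply: linear_ext => m.
exact: (congr1 (fun f : dual I (dual I (resl H)) => f m)
          (Kw (dual_map dual_to_D z))).
Qed.
End LeftBidual.

Section RightBidual.
Variable M : lmodType S^c.

Definition dual_to_D' : dual I (resr M) -> resl (D'_obj Psi M) := id.
Fact dual_to_D'_is_linear : linear dual_to_D'.
Proof. by move=> r m n; rewrite restr_scaleE left_skewC. Qed.
HB.instance Definition _ :=
  GRing.isLinear.Build R (dual I (resr M)) (resl (D'_obj Psi M)) *:%R
    dual_to_D' dual_to_D'_is_linear.

Section At.
Variable m : M.
Definition right_eval_at (h : resl (D'_obj Psi M)) : I :=
  (h : dual I (resr M)) m.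
Fact right_eval_at_is_linear : linear right_eval_at.
Proof.
by move=> r h k; rewrite /right_eval_at restr_scaleE left_skewC.
Qed.
HB.instance Definition _ :=
  GRing.isLinear.Build R (resl (D'_obj Psi M)) I *:%R
    right_eval_at right_eval_at_is_linear.
End At.

Definition right_eval (m : M) : D_obj Psi (D'_obj Psi M) :=
  right_eval_at m : {linear resl (D'_obj Psi M) -> I}.

Fact right_eval_is_linear : linear right_eval.
Proof.
apply: right_linearP => [m n | r m | m].
- by apply: linear_ext => h; exact: (raddfD (h : dual I (resr M))).
- rewrite right_skewC; apply: linear_ext => h.
  exact: (linearZ_LR (h : dual I (resr M)) r (m : resr M)).
rewrite right_skewX; apply: linear_ext => h.
(* Here [Psi] meets its own inverse directly; what remains is the map [r' |-> h ((m r') x)] taken at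
   [r' = 1]. *)
rewrite /= /D_fun /right_eval /= /right_eval_at left_skewX /= /D'_val bim_invK.
by rewrite /= /D'_fun scale1r.
Qed.
HB.instance Definition _ :=
  GRing.isLinear.Build S^c M (D_obj Psi (D'_obj Psi M)) *:%R
    right_eval right_eval_is_linear.

Lemma right_eval_bijective : reflexive_right I M -> bijective right_eval.
Proof.
case=> w wK Kw; exists (fun z => w (dual_map dual_to_D' z)) => [m | z].
  by rewrite -[RHS]wK; congr (w _); apply: linear_ext.
apply: linear_ext => h.
exact: (congr1 (fun f : dual I (dual I (resr M)) => f h)
          (Kw (dual_map dual_to_D' z))).
Qed.
End RightBidual.

End Biduality.

Theorem theorem1p20 (R : comNzRingType) (p : nat) (charRp : p \in [pchar R])
    (noethR : noetherian R) (FfinR : F_finite charRp)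
    (I : lmodType R) (injI : injective_module I)
    (Psi : bimod_iso (f_I charRp I) (Hom_r (R_f charRp) (sym_bimod I))) :
  inverse_equivalences
    (D Psi : functor (L_I charRp I) (opposite (R_I charRp I)))
    (flip_functor (D' Psi : functor (R_I charRp I) (opposite (L_I charRp I)))).
Proof.
split.
  apply: naturally_isomorphic_sym.
  exists (fun H : L_I charRp I => left_eval Psi (H := sval H) : {linear _ -> _}).
  split=> [[H reflH] | H K u].
    have [v vP] := bijective_linear_iso (left_eval_bijective Psi reflH).
    by exists v.
  by apply: linear_ext => h; apply: linear_ext.
exists (fun M : R_I charRp I => right_eval Psi (M := sval M) : {linear _ -> _}).
split=> [[M reflM] | M N u].
  have [v [vK Kv]] := bijective_linear_iso (right_eval_bijective Psi reflM).
  by exists v; split.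
by apply: linear_ext => m; apply: linear_ext.
Qed.
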